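(* Let $n \geq 2$ and let $z_1,\dots,z_n$ be the standard coordinates on $\mathbb{C}^n$. Consider the polynomial vector fields $$U = \frac{\partial}{\partial z_n},$$ $$V = \frac{\partial}{\partial z_n} + \sum_{k=2}^{n} \Big(\prod_{j=k+1}^{n} z_j\Big) z_k^3 \,\frac{\partial}{\partial z_{k-1}} = \frac{\partial}{\partial z_n} + z_n^3 \frac{\partial}{\partial z_{n-1}} + z_n z_{n-1}^3 \frac{\partial}{\partial z_{n-2}} + \dots + z_n z_{n-1}\cdots z_3 z_2^3 \frac{\partial}{\partial z_1},$$ $$W = z_1^2 \cdots z_{n-1}^2 \cdot z_n \frac{\partial}{\partial z_n}.$$ Then $U$, $V$ and $W$ are complete, and they generate the complex Lie algebra of all polynomial vector fields on $\mathbb{C}^n$; that is, the smallest complex Lie algebra of vector fields containing $U$, $V$, $W$ is the Lie algebra of all polynomial vector fields on $\mathbb{C}^n$.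
   Context: A polynomial vector field on $\mathbb{C}^n$ is a vector field $\sum_{i=1}^n f_i \frac{\partial}{\partial z_i}$ with $f_i \in \mathbb{C}[z_1,\dots,z_n]$; these form a complex Lie algebra under the usual commutator bracket. A holomorphic vector field is called complete (or completely integrable) if its flow map exists for all complex times. Empty products equal $1$. *)

(* Defs.v *)
From HB Require Import structures.
From mathcomp Require Import all_boot all_order all_algebra.
From mathcomp Require Import all_classical all_reals all_analysis.
From mathcomp Require Import complex.
(* The notations of mpoly clash with those of mathcomp-analysis, hence the
   restricted import; the one used below is restored locally. *)
From mathcomp Require Import (canonicals, coercions) mpoly.

Set Implicit Arguments.
Unset Strict Implicit.
Unset Printing Implicit Defensive.

Import GRing.Theory.
Import numFieldNormedType.Exports.

Local Open Scope ring_scope.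

Local Notation "{ 'mpoly' T [ n ] }" := (mpoly.mpoly n T)
  (at level 0, T at level 2, format "{ 'mpoly'  T [ n ] }") : type_scope.

Section VectorFields.
Variables (K : comNzRingType) (n : nat).

(* The row vector f stands for the vector field \sum_i f_i d/dz_i; i : 'I_n
   indexes the coordinate z_(i+1). *)
Definition vfield := 'rV[{mpoly K[n]}]_n.

Implicit Types (X Y : vfield) (p q : {mpoly K[n]}).

Definition vf_action X p : {mpoly K[n]} :=
  \sum_(i < n) X 0 i * mpoly.mderiv i p.

Definition bracket X Y : vfield :=
  \row_(j < n) (vf_action X (Y 0 j) - vf_action Y (X 0 j)).

Lemma bracketE X Y p :
  vf_action (bracket X Y) p =
  vf_action X (vf_action Y p) - vf_action Y (vf_action X p).
Proof.
have actE A B : vf_action A (vf_action B p) =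
    \sum_(j < n) vf_action A (B 0 j) * mpoly.mderiv j p +
    \sum_(i < n) \sum_(j < n)
       A 0 i * (B 0 j * mpoly.mderiv i (mpoly.mderiv j p)).
  rewrite /vf_action [X in _ = _ + X]exchange_big -big_split.
  under [LHS]eq_bigr => i _ do rewrite raddf_sum mulr_sumr.
  rewrite [LHS]exchange_big /=; apply: eq_bigr => j _.
  rewrite mulr_suml -big_split /=; apply: eq_bigr => i _.
  by rewrite mpoly.mderivM mulrDr !mulrA.
rewrite !actE opprD addrACA -sumrB.
rewrite [X in _ + (X - _)]exchange_big /= -[LHS]addr0; congr (_ + _).
  by apply: eq_bigr => j _; rewrite mxE mulrBl.
apply/esym/eqP; rewrite subr_eq0; apply/eqP.
apply: eq_bigr => i _; apply: eq_bigr => j _.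
by rewrite mulrCA mpoly.mderiv_comm.
Qed.

(* 'rV[{mpoly K[n]}]_n is a module over the polynomials in the library: the
   scalars c : K act through the constant polynomials. *)
Definition lie_subalgebra (S : vfield -> Prop) : Prop :=
  [/\ S 0,
      forall X Y, S X -> S Y -> S (X + Y),
      forall c X, S X -> S (mpoly.mpolyC n c *: X)
    & forall X Y, S X -> S Y -> S (bracket X Y)].

(* The intersection of all Lie subalgebras containing G. *)
Definition lie_generated (G : vfield -> Prop) (X : vfield) : Prop :=
  forall S : vfield -> Prop, lie_subalgebra S ->
    (forall Y, G Y -> S Y) -> S X.

(* The coordinate z_k and the field d/dz_k, with the 1-based numbering
   1 <= k <= n (both are 0 for other k). *)
Definition coord (k : nat) : {mpoly K[n]} :=
  \sum_(i < n | i.+1 == k) mpoly.mpolyX K (mpoly.mnm1 i).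

Definition partial (k : nat) : vfield := \row_(i < n) (i.+1 == k)%:R.

Definition fieldU : vfield := partial n.

Definition fieldV : vfield :=
  partial n +
  \sum_(2 <= k < n.+1)
     ((\prod_(k.+1 <= j < n.+1) coord j) * coord k ^+ 3) *: partial k.-1.

Definition fieldW : vfield :=
  ((\prod_(1 <= j < n) coord j ^+ 2) * coord n) *: partial n.

End VectorFields.

(* Complex differentiability in t: the derivative at t in direction 1 in the
   normed space R[i]^o over the field R[i]. The group law of phi is not
   required, as it follows from the uniqueness of integral curves. *)
Definition is_flow (R : realType) (n : nat) (X : vfield R[i] n)
    (phi : R[i] -> 'rV[R[i]]_n -> 'rV[R[i]]_n) : Prop :=
  (forall z, phi 0 z = z) /\
  (forall (z : 'rV[R[i]]_n) (t : R[i]^o) (i : 'I_n),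
     is_derive t (1 : R[i]^o) (fun s : R[i]^o => phi s z 0 i : R[i]^o)
       (mpoly.meval (phi t z 0) (X 0 i))).

Definition complete_vfield (R : realType) (n : nat) (X : vfield R[i] n) : Prop :=
  exists phi, is_flow X phi.

(* Main.v *)
(* Let L be a Lie algebra containing U, V, W, and write P_j for the set of
   polynomials p with p d/dz_j in L.

   The part of V - U in the directions below z_k is
   B_k = z_k^3 d/dz_{k-1} + z_k B_{k-1}, with B_{k-1} free of z_k.  Bracketing with
   d/dz_k turns B_k into 3 z_k^2 d/dz_{k-1} + B_{k-1}, and further brackets give
   z_k d/dz_{k-1} and d/dz_{k-1}; so L contains all d/dz_k by descending
   induction, starting from U.  Hence P_n contains every monomial dividing
   z_1^2 ... z_{n-1}^2 z_n, and z_n lies in every P_j.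

   For a, j < n, the following brackets then produce all polynomial fields:
   - [p d_n, z_a z_n d_n] = p z_a d_n for p free of z_n puts C[z_1..z_{n-1}]
     in P_n;
   - [p d_n, z_n d_j] = p d_j - z_n (d_j p) d_n moves p from P_n to P_j as soon
     as z_n d_j p is in P_n; in particular z_a z_j is in P_j, and bracketing with
     z_a z_j d_j shows that z_n C[z_1..z_{n-1}] is in P_n, so that
     C[z_1..z_{n-1}] is in P_j;
   - P_j is stable under z_n d_j, hence contains every polynomial;
   - [p d_j, z_j d_n] = p d_n - z_j (d_n p) d_j then does the same for P_n.

   U and V are triangular: the i-th component only involves z_j with j > i.  For
   such fields Picard iteration in C[t] becomes stationary after n steps, which
   gives a polynomial flow.  The flow of W multiplies z_n by
   exp (t z_1^2 ... z_{n-1}^2). *)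
Require Import Defs.
From mathcomp Require Import all_boot all_order all_algebra.
From mathcomp Require Import all_classical all_reals all_analysis.
From mathcomp Require Import complex.
From mathcomp Require Import (canonicals, coercions) mpoly.
From mathcomp Require Import ring lra.

Set Implicit Arguments.
Unset Strict Implicit.
Unset Printing Implicit Defensive.

Import Order.TTheory GRing.Theory Num.Theory.
Import numFieldNormedType.Exports.

Local Open Scope ring_scope.

(** * Generation of the Lie algebra *)

Section Monomials.
Variables (K : comNzRingType) (n : nat).

Local Notation mon := (@mpoly.mpolyX n K).
Local Notation u_ i := (@mpoly.mnm1 n i).
Local Notation x_ i := (mon (u_ i)).

(** Induction on the degree: an exponent vector of positive degree has a nonzero entry, from which
    one unit is split off. *)
Lemma mnm_ind (Q : mpoly.multinom n -> Prop) :
  Q mpoly.mnm0 -> (forall i m, Q m -> Q (mpoly.mnm_add (u_ i) m)) ->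
  forall m, Q m.
Proof.
move=> Q0 QS m; move: {2}(mpoly.mdeg m) (erefl (mpoly.mdeg m)) => d.
elim: d m => [|d IHd] m /eqP degm.
  by move: degm; rewrite mpoly.mdeg_eq0 => /eqP ->.
have [i mi] : exists i, m i != 0%N.
  apply/existsP; apply: contraLR degm; rewrite negb_exists => /forallP m0.
  suff -> : m = mpoly.mnm0 by rewrite mpoly.mdeg0.
  apply/mpoly.mnmP => i; rewrite mpoly.mnm0E; apply/eqP.
  by rewrite -[_ == _]negbK m0.
have le_im : mpoly.lem (u_ i) m by rewrite mpoly.lep1mP.
move: degm; rewrite -(mpoly.submK le_im) [mpoly.mnm_add _ _]mpoly.addmC.
rewrite mpoly.mdegD mpoly.mdeg1 add1n eqSS => /eqP degm.
exact/QS/IHd.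
Qed.

Lemma mderiv_mpolyXU i j :
  mpoly.mderiv j (mon (u_ i)) = (i == j)%:R.
Proof.
rewrite mpoly.mderivX mpoly.mnm1E; case: eqP => [->|_]; last by rewrite scale0r.
rewrite scale1r; suff -> : mpoly.mnm_sub (u_ j) (u_ j) = mpoly.mnm0.
  exact: mpoly.mpolyX0.
by apply/mpoly.mnmP => k; rewrite mpoly.mnmBE mpoly.mnm0E subnn.
Qed.

Lemma mpolyXU_mderiv i (m : mpoly.multinom n) :
  mon (u_ i) * mpoly.mderiv i (mon m) = (m i)%:R *: mon m.
Proof.
rewrite mpoly.mderivX -scalerAr -mpoly.mpolyXD.
(* When variable [i] does not occur, the subtraction of exponents is truncated, but the coefficient
   in front vanishes. *)
have [->|mi] := eqVneq (m i) 0%N; first by rewrite !scale0r.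
by rewrite [mpoly.mnm_add _ _]mpoly.addmC mpoly.submK // mpoly.lep1mP.
Qed.

Lemma mderiv_mpolyX_eq0 i (m : mpoly.multinom n) :
  m i = 0%N -> mpoly.mderiv i (mon m) = 0.
Proof. by move=> mi; rewrite mpoly.mderivX mi scale0r. Qed.

End Monomials.

(** * Fields with a single component and their brackets *)

Section MonomialFields.
Variables (K : comNzRingType) (n : nat).
Implicit Types (p q : mpoly.mpoly n K) (i j : 'I_n) (X : vfield K n).

Definition coord_field p i : vfield K n := p *: delta_mx 0 i.

Lemma vf_action_coord_field p i q :
  vf_action (coord_field p i) q = p * mpoly.mderiv i q.
Proof.
rewrite /vf_action (bigD1 i) //= big1 => [|j ji].
  by rewrite !mxE !eqxx mulr1 addr0.
by rewrite !mxE (negPf ji) andbF mulr0 mul0r.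
Qed.

Lemma bracket_coord_field p i q j :
  bracket (coord_field p i) (coord_field q j) =
  coord_field (p * mpoly.mderiv i q) j - coord_field (q * mpoly.mderiv j p) i.
Proof.
apply/rowP => k; rewrite !mxE !vf_action_coord_field !mpoly.mderivM.
have d0 (b : bool) l : mpoly.mderiv l (b%:R : mpoly.mpoly n K) = 0.
  by case: b; [rewrite -(mpoly.mpolyC1 n K) mpoly.mderivC | rewrite raddf0].
by rewrite !d0 !mulr0 !addr0 !mulrA.
Qed.

Lemma coord_fieldD p q i :
  coord_field (p + q) i = coord_field p i + coord_field q i.
Proof. exact: scalerDl. Qed.

Lemma coord_field0 i : coord_field 0 i = 0.
Proof. exact: scale0r. Qed.

Lemma coord_fieldZ (c : K) p i :
  coord_field (c *: p) i = mpoly.mpolyC n c *: coord_field p i.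
Proof. by rewrite /coord_field scalerA mpoly.mul_mpolyC. Qed.

Lemma vfield_sum X : X = \sum_i coord_field (X 0 i) i.
Proof. by rewrite [LHS]row_sum_delta. Qed.

End MonomialFields.

(** * Closure properties of a Lie subalgebra *)

Section LieSubalgebra.
Variables (K : numFieldType) (n : nat) (S : vfield K n -> Prop).
Hypothesis lieS : lie_subalgebra S.
Implicit Types (p q : mpoly.mpoly n K) (i j : 'I_n) (m : mpoly.multinom n).
Implicit Types X Y : vfield K n.

Local Notation mon := (@mpoly.mpolyX n K).
Local Notation u_ i := (@mpoly.mnm1 n i).
Local Notation x_ i := (mon (u_ i)).
Local Notation P := (fun p i => S (coord_field p i)).

Lemma lie0 : S 0. Proof. by case: lieS. Qed.

Lemma lieD X Y : S X -> S Y -> S (X + Y).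
Proof. by case: lieS => _ + _ _; apply. Qed.

Lemma lieZ c X : S X -> S (mpoly.mpolyC n c *: X).
Proof. by case: lieS => _ _ + _; apply. Qed.

Lemma lieN X : S X -> S (- X).
Proof. by move=> /(lieZ (-1)); rewrite mpoly.mpolyCN mpoly.mpolyC1 scaleN1r. Qed.

Lemma lieB X Y : S X -> S Y -> S (X - Y).
Proof. by move=> SX SY; apply/lieD/lieN. Qed.

Lemma lie_bracket X Y : S X -> S Y -> S (bracket X Y).
Proof. by case: lieS => _ _ _; apply. Qed.

(** Characteristic zero enters here: the integers produced by differentiating monomials can be
    divided out. *)
Lemma lie_divn (m : nat) p i : m != 0%N -> P (m%:R *: p) i -> P p i.
Proof.
move=> m0 /(lieZ m%:R^-1); rewrite -coord_fieldZ scalerA mulVf ?scale1r //.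
by rewrite pnatr_eq0.
Qed.

Lemma lie_monomials i : (forall m, P (mon m) i) -> forall p, P p i.
Proof.
move=> Pm p; rewrite (mpoly.mpolyE p); elim: (mpoly.msupp p) => [|m s IHs].
  by rewrite big_nil coord_field0; exact: lie0.
rewrite big_cons coord_fieldD coord_fieldZ; apply/lieD/IHs.
exact/lieZ/Pm.
Qed.

(** * From a few low-degree fields to all fields; [l] is the index of z_n *)

Section Generation.
Variable l : 'I_n.
Hypothesis n_ge2 : exists j, j != l.
Hypothesis P_l : forall j, P (x_ l) j.
Hypothesis P_quad : forall j, j != l -> P (x_ j * x_ l) l.
Hypothesis P_lin : forall j, j != l -> P (x_ j) l.
Hypothesis P_1 : P 1 l.

Lemma lie_shift p j : j != l -> P p l -> P (x_ l * mpoly.mderiv j p) l -> P p j.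
Proof.
move=> jl Pp /(lieD (lie_bracket Pp (P_l j))).
by rewrite bracket_coord_field subrK mderiv_mpolyXU eqxx mulr1.
Qed.

(** Bracketing with z_i z_l d_l multiplies a coefficient free of z_l by z_i. *)
Lemma lie_mon_last m : m l = 0%N -> P (mon m) l.
Proof.
elim/mnm_ind: m => [_|i m IHm]; first by rewrite mpoly.mpolyX0.
rewrite mpoly.mnmDE mpoly.mnm1E; case: (eqVneq i l) => // il.
rewrite add0n => ml.
have := lie_bracket (IHm ml) (P_quad il).
rewrite bracket_coord_field mpoly.mderivM !mderiv_mpolyXU eqxx (negPf il).
rewrite mul0r add0r mulr1 mderiv_mpolyX_eq0 // mulr0 coord_field0 subr0.
by rewrite mulrC -mpoly.mpolyXD.
Qed.

(** The correction term of [lie_shift] is a sum of products z_l z_k with k different from [l], all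
    covered by [P_quad]. *)
Lemma lie_quad_diag i j : i != l -> j != l -> P (x_ i * x_ j) j.
Proof.
move=> il jl; apply: lie_shift => //.
  rewrite -mpoly.mpolyXD; apply: lie_mon_last.
  by rewrite mpoly.mnmDE !mpoly.mnm1E (negPf il) (negPf jl).
rewrite mpoly.mderivM !mderiv_mpolyXU eqxx mulr1 mulrDr coord_fieldD.
apply: lieD; last by rewrite mulrC; exact: P_quad.
case: eqP => [_|_]; first by rewrite mul1r mulrC; exact: P_quad.
by rewrite mul0r mulr0 coord_field0; exact: lie0.
Qed.

Lemma lie_mon_mulX m : m l = 0%N -> P (x_ l * mon m) l.
Proof.
elim/mnm_ind: m => [_|i m IHm]; first by rewrite mpoly.mpolyX0 mulr1.
rewrite mpoly.mnmDE mpoly.mnm1E; case: (eqVneq i l) => // il.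
rewrite add0n => ml.
(* A nonconstant [m] contains some z_j, and then bracketing with z_i z_j d_j multiplies by m_j z_i
   with m_j nonzero. The constant monomial has no such j. *)
have [/eqP|] := boolP (mpoly.mdeg m == 0%N).
  move=> /eqP; rewrite mpoly.mdeg_eq0 => /eqP ->.
  by rewrite mpoly.addm0 mulrC; exact: P_quad.
rewrite mpoly.mdegE sum_nat_eq0 negb_forall => /existsP[j /= mj].
have jl : j != l by apply: contraNneq mj => ->; rewrite ml.
have := lie_bracket (lie_quad_diag il jl) (IHm ml).
rewrite bracket_coord_field [X in _ - coord_field (_ * X) _]mpoly.mderivM.
rewrite [X in coord_field (_ * X) _ - _]mpoly.mderivM !mderiv_mpolyXU.
rewrite (negPf il) [l == j]eq_sym (negPf jl) !mul0r mulr0 addr0 mulr0.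
rewrite coord_field0 subr0 add0r => H.
apply: (lie_divn mj); move: H; rewrite mpoly.mpolyXD.
rewrite -mulrA [X in _ * X]mulrCA mpolyXU_mderiv -!scalerAr.
by rewrite mulrCA.
Qed.

Lemma lie_mon0 j m : j != l -> m l = 0%N -> P (mon m) j.
Proof.
move=> jl ml; apply: lie_shift => //; first exact: lie_mon_last.
rewrite mpoly.mderivX -scalerAr coord_fieldZ; apply/lieZ/lie_mon_mulX.
by rewrite mpoly.mnmBE ml.
Qed.

(** Induction on the exponent of z_l, which the bracket with z_l d_j raises at the expense of
    z_j. *)
Lemma lie_mon j m : j != l -> P (mon m) j.
Proof.
move=> jl; move: {2}(m l) (erefl (m l)) => k; elim: k m => [|k IHk] m ml.
  exact: lie_mon0.
have le_lm : mpoly.lem (u_ l) m by rewrite mpoly.lep1mP ml.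
pose m' := mpoly.mnm_sub m (u_ l).
have def_m : mon m = x_ l * mon m'.
  by rewrite -mpoly.mpolyXD [mpoly.mnm_add _ _]mpoly.addmC mpoly.submK.
(* One factor z_l is traded for z_j; the bracket trades it back, with the nonzero factor m'_j +
   1. *)
have := IHk (mpoly.mnm_add (u_ j) m').
rewrite mpoly.mnmDE mpoly.mnmBE !mpoly.mnm1E eqxx (negPf jl) ml subn1.
move=> /(_ erefl) /(lie_bracket (P_l j)).
rewrite bracket_coord_field mderiv_mpolyXU eq_sym (negPf jl) mulr0.
rewrite coord_field0 subr0 mpoly.mpolyXD mpoly.mderivM mderiv_mpolyXU eqxx.
rewrite mul1r mpolyXU_mderiv -[X in X + _]scale1r -scalerDl -scalerAr.
rewrite -def_m -mulrS.
exact: lie_divn.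
Qed.

Lemma lie_full X : S X.
Proof.
have Pj j p : j != l -> P p j.
  by move=> jl; apply: lie_monomials => m; exact: lie_mon.
have Pl p : P p l.
  have [j jl] := n_ge2.
  (* The bracket is p d_l - z_j (d_l p) d_j, and its second term is already known. *)
  have := lie_bracket (Pj j p jl) (P_lin jl).
  rewrite bracket_coord_field mderiv_mpolyXU eqxx mulr1.
  by move=> /lieD /(_ (Pj j (x_ j * mpoly.mderiv l p) jl)); rewrite subrK.
rewrite (vfield_sum X); elim/big_ind: _ => [||i _]; [exact: lie0|exact: lieD|].
by case: (eqVneq i l) => [->|/Pj].
Qed.

End Generation.
End LieSubalgebra.

(** * Brackets with constant fields and the recursive structure of V *)

Section FieldDerivative.
Variables (K : comNzRingType) (n : nat).
Implicit Types (p q : mpoly.mpoly n K) (i j : 'I_n) (X Y : vfield K n).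

Definition dfield i X : vfield K n := map_mx (mpoly.mderiv i) X.

Lemma bracket_dfield i X : bracket (coord_field 1 i) X = dfield i X.
Proof.
apply/rowP => k; rewrite !mxE vf_action_coord_field mul1r.
rewrite [X in _ - X]big1 ?subr0 // => j _; rewrite mul1r.
case: (_ && _); last by rewrite raddf0 mulr0.
by rewrite -(mpoly.mpolyC1 n K) mpoly.mderivC mulr0.
Qed.

Lemma dfieldD i X Y : dfield i (X + Y) = dfield i X + dfield i Y.
Proof. exact: map_mxD. Qed.

Lemma dfield0 i : dfield i 0 = 0.
Proof. exact: map_mx0. Qed.

Lemma dfieldZ i p X :
  dfield i (p *: X) = mpoly.mderiv i p *: X + p *: dfield i X.
Proof. by apply/rowP => k; rewrite !mxE mpoly.mderivM. Qed.

Lemma dfield_coord_field i p j :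
  dfield i (coord_field p j) = coord_field (mpoly.mderiv i p) j.
Proof.
rewrite dfieldZ -[RHS]addr0; congr (_ + _); apply/rowP => k; rewrite !mxE.
case: (_ && _); last by rewrite raddf0 mulr0.
by rewrite -(mpoly.mpolyC1 n K) mpoly.mderivC mulr0.
Qed.

Lemma partialE i : partial K n i.+1 = coord_field 1 i.
Proof.
by apply/rowP => k; rewrite !mxE mul1r eqSS eqxx /= -val_eqE.
Qed.

Lemma scale_partialE p i : p *: partial K n i.+1 = coord_field p i.
Proof. by rewrite partialE /coord_field scale1r. Qed.

Lemma coordE i : Defs.coord K n i.+1 = mpoly.mpolyX K (mpoly.mnm1 i).
Proof. by rewrite /Defs.coord (big_pred1 i) // => j; rewrite eqSS. Qed.

(* [tower n] is V - d/dz_n, and [tower k] its analogue in the first k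
   coordinates. *)
Definition tower (k : nat) : vfield K n :=
  \sum_(2 <= j < k.+1)
     ((\prod_(j.+1 <= i < k.+1) Defs.coord K n i) * Defs.coord K n j ^+ 3)
       *: partial K n j.-1.

Lemma fieldVE : fieldV K n = partial K n n + tower n.
Proof. by []. Qed.

Lemma tower1 : tower 1 = 0.
Proof. by rewrite /tower big_geq. Qed.

Lemma towerS k : (0 < k)%N ->
  tower k.+1 =
  Defs.coord K n k.+1 ^+ 3 *: partial K n k + Defs.coord K n k.+1 *: tower k.
Proof.
move=> k0; rewrite /tower big_nat_recr //= addrC; congr (_ + _).
  by rewrite big_geq // mul1r.
rewrite scaler_sumr; apply: eq_big_nat => j /andP[_ jk].
by rewrite scalerA big_nat_recr //= mulrA [_ * Defs.coord _ _ k.+1]mulrC.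
Qed.

(** Ordinals are 0-based: [dfield i] differentiates by z_(i+1), while [tower k] involves only z_1,
    ..., z_k. *)
Lemma dfield_tower i k : (k <= i)%N -> dfield i (tower k) = 0.
Proof.
elim: k => [|[|k] IHk] ki.
- by rewrite /tower big_geq // dfield0.
- by rewrite tower1 dfield0.
have kn := ltn_trans ki (ltn_ord i); have k'n := ltnW kn.
rewrite towerS // (scale_partialE _ (Ordinal k'n)) (coordE (Ordinal kn)).
rewrite dfieldD dfield_coord_field dfieldZ IHk ?scaler0; last first.
  exact: ltnW.
rewrite !exprS expr0 mulr1 !mpoly.mderivM !mderiv_mpolyXU -val_eqE /=.
by rewrite ltn_eqF // !(mul0r,mulr0,addr0) coord_field0 scale0r addr0.
Qed.

(** In [towerS] the inner tower is free of the new variable, so the product rule strips its linear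
    prefactor. *)
Lemma dfield_towerS i j : j = i.+1 :> nat ->
  dfield j (tower j.+1) =
  coord_field (3%:R *: mpoly.mpolyX K (mpoly.mnm1 j) ^+ 2) i + tower i.+1.
Proof.
move=> ji; have j0 : (0 < j)%N by rewrite ji.
have -> : tower i.+1 = tower j by rewrite ji.
have partial_ji : partial K n j = partial K n i.+1 by rewrite ji.
rewrite (towerS j0) (coordE j) partial_ji scale_partialE dfieldD dfieldZ.
rewrite (dfield_tower (leqnn _)) scaler0 addr0 dfield_coord_field.
rewrite mderiv_mpolyXU eqxx scale1r; congr (coord_field _ _ + _).
rewrite !exprS expr0 mulr1 !mpoly.mderivM mderiv_mpolyXU eqxx scaler_nat.
by rewrite !mul1r mulr1 mulrDr mulrS mulr2n.
Qed.

End FieldDerivative.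

(** * Constant and low-degree fields from U, V and W, with n = [N.+1] *)

Section Generators.
Variables (K : numFieldType) (N : nat) (S : vfield K N.+1 -> Prop).
Hypotheses (N_gt0 : (0 < N)%N) (lieS : lie_subalgebra S).
Hypotheses (SU : S (fieldU K N.+1)) (SV : S (fieldV K N.+1)).
Hypothesis SW : S (fieldW K N.+1).
Implicit Types (i j : 'I_N.+1) (m : mpoly.multinom N.+1).

Local Notation mon := (@mpoly.mpolyX N.+1 K).
Local Notation u_ i := (@mpoly.mnm1 N.+1 i).
Local Notation x_ i := (mon (u_ i)).
Local Notation P := (fun p i => S (coord_field p i)).

Lemma lie_partial_last : P 1 ord_max.
Proof. by have := SU; rewrite /fieldU (partialE K ord_max). Qed.

Lemma lie_dfield i X : P 1 i -> S X -> S (dfield i X).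
Proof. by move=> Pi SX; rewrite -bracket_dfield; apply: lie_bracket. Qed.

(* [X] collects the terms free of z_(i+1), which [dfield i] kills. *)
Lemma lie_descent d i : (i + d = N)%N ->
  [/\ P 1 i, P (x_ ord_max) ord_max -> P (x_ ord_max) i &
      exists2 X, dfield i X = 0 & S (X + tower K N.+1 i.+1)].
Proof.
elim: d i => [|d IHd] i id.
  have -> : i = ord_max by apply: val_inj; rewrite -[LHS]addn0 id.
  split; [exact: lie_partial_last | by [] |].
  (* At the top the tower is V - U. *)
  exists 0; first exact: dfield0.
  rewrite add0r -[tower _ _ _](addKr (partial K N.+1 N.+1)) -fieldVE addrC.
  exact: lieB.
have iN : (i.+1 < N.+1)%N by move: (leq_addr d i.+1); rewrite addSnnS id.
have := IHd (Ordinal iN); set j := Ordinal iN => /(_ _)[].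
  by rewrite addSnnS.
move=> Pj Plj [X DX SX].
have ij : (i == j) = false by rewrite -val_eqE /= ltn_eqF.
have S1 : S (coord_field (3%:R *: x_ j ^+ 2) i + tower K N.+1 i.+1).
  rewrite -(@dfield_towerS K _ i j (erefl _)) -[dfield _ _]add0r -DX -dfieldD.
  exact: lie_dfield.
(* A second bracket with d_j kills the lower tower and leaves 6 z_j d_i. *)
have S2 : P (x_ j) i.
  have := lie_dfield Pj S1.
  rewrite dfieldD (dfield_tower K (leqnn j)) addr0 dfield_coord_field.
  rewrite mpoly.mderivZ expr2 mpoly.mderivM mderiv_mpolyXU eqxx mul1r mulr1.
  move=> /(lie_divn lieS (isT : 3 != 0%N)); rewrite -mulr2n -[_ *+ 2]scaler_nat.
  exact: lie_divn.
have Pi : P 1 i.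
  have := lie_dfield Pj S2.
  by rewrite dfield_coord_field mderiv_mpolyXU eqxx.
have i_max : (ord_max == i) = false.
  by rewrite eq_sym -val_eqE /= ltn_eqF.
split; first exact: Pi.
  (* The bracket of z_n d_j with z_j d_i is z_n d_i, since [i] is not the last index. *)
  move=> /Plj Pl; have := lie_bracket lieS Pl S2.
  rewrite bracket_coord_field !mderiv_mpolyXU eqxx mulr1 i_max mulr0.
  by rewrite coord_field0 subr0.
exists (coord_field (3%:R *: x_ j ^+ 2) i); last exact: S1.
rewrite dfield_coord_field mpoly.mderivZ expr2 mpoly.mderivM mderiv_mpolyXU.
by rewrite eq_sym ij mul0r mulr0 addr0 scaler0 coord_field0.
Qed.

(** Induction on the quotient: each bracket with a constant field lowers one exponent, up to a
    nonzero integer. *)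
Lemma lie_divisor m m' i : (forall j, P 1 j) -> mpoly.lem m' m ->
  P (mon m) i -> P (mon m') i.
Proof.
move=> P1 /mpoly.submK <-; elim/mnm_ind: (mpoly.mnm_sub _ _) => [|j d IHd].
  by rewrite mpoly.add0m.
rewrite -mpoly.addmA; set b := mpoly.mnm_add d m' in IHd *.
move=> /(lie_dfield (P1 j)); rewrite dfield_coord_field mpoly.mderivX.
rewrite [mpoly.mnm_add _ _]mpoly.addmC mpoly.addmK mpoly.mnmDE mpoly.mnm1E eqxx.
by rewrite addn1 => /(lie_divn lieS (isT : _.+1 != 0%N)).
Qed.

Definition mnmW : mpoly.multinom N.+1 :=
  mpoly.Multinom [tuple if i == ord_max then 1%N else 2 | i < N.+1].

Lemma mnmWE i : mnmW i = if i == ord_max then 1%N else 2.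
Proof. exact: mpoly.mnmE. Qed.

Lemma lie_mnmW : P (mon mnmW) ord_max.
Proof.
have := SW; rewrite /fieldW (scale_partialE _ ord_max) (coordE _ ord_max).
congr (S (coord_field _ _)).
rewrite [mon mnmW]mpoly.mpolyXE_id big_ord_recr mnmWE eqxx expr1 /=.
congr (_ * _).
rewrite big_add1 big_mkord; apply: eq_bigr => i _.
rewrite (coordE _ (widen_ord (leqnSn N) i)) mnmWE -val_eqE /=.
by rewrite ltn_eqF.
Qed.

Lemma lie_generators_full X : S X.
Proof.
have P1 i : P 1 i /\ (P (x_ ord_max) ord_max -> P (x_ ord_max) i).
  have iN : (i <= N)%N by rewrite -ltnS ltn_ord.
  by have [] := lie_descent (subnKC iN).
have W_div m : mpoly.lem m mnmW -> P (mon m) ord_max.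
  by move=> /lie_divisor; apply; [move=> j; case: (P1 j) | exact: lie_mnmW].
have le1W j : mpoly.lem (u_ j) mnmW.
  by rewrite mpoly.lep1mP mnmWE; case: ifP.
apply: (@lie_full _ _ _ lieS ord_max) => [|j|j jl|j _|].
- by exists ord0; rewrite -val_eqE /= eq_sym -lt0n.
(* z_n d_n is a descendant of W, reached through all the constant fields; hence it is a premise in
   [lie_descent]. *)
- by case: (P1 j) => _; apply; exact: W_div.
- rewrite -mpoly.mpolyXD; apply: W_div; apply/mpoly.mnm_lepP => k.
  rewrite mpoly.mnmDE !mpoly.mnm1E mnmWE [k == _]eq_sym.
  by case: (eqVneq ord_max k) => [<-|_]; rewrite ?(negPf jl) //; case: (j == k).
- exact: W_div.
- by case: (P1 ord_max).
Qed.

End Generators.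

(** * Completeness *)

Section ComplexExponential.
Variable R : realType.
Implicit Types (x y e d : R) (z w : R[i]).
Local Open Scope complex_scope.

(** The norm of [R[i]] takes its values in [R[i]], so real bounds are embedded by [%:C]. *)
Lemma Re_le_norm z : `|complex.Re z|%:C <= `|z|.
Proof.
rewrite normc_def lecR -[X in X <= _]ger0_norm ?normr_ge0 // -sqrtr_sqr.
by rewrite ler_sqrt ?addr_ge0 ?sqr_ge0 // real_normK ?num_real // lerDl sqr_ge0.
Qed.

Lemma Im_le_norm z : `|complex.Im z|%:C <= `|z|.
Proof.
rewrite normc_def lecR -[X in X <= _]ger0_norm ?normr_ge0 // -sqrtr_sqr.
by rewrite ler_sqrt ?addr_ge0 ?sqr_ge0 // real_normK ?num_real // lerDr sqr_ge0.
Qed.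

Lemma norm_le_ReIm z : `|z| <= (`|complex.Re z| + `|complex.Im z|)%:C.
Proof.
rewrite normc_def lecR -[X in _ <= X]ger0_norm ?addr_ge0 // -sqrtr_sqr.
rewrite ler_sqrt ?sqr_ge0 // sqrrD !real_normK ?num_real //.
by rewrite addrAC lerDl mulrn_wge0 // mulr_ge0.
Qed.

Definition expC z : R[i] :=
  (expR (complex.Re z) * cos (complex.Im z)) +i*
  (expR (complex.Re z) * sin (complex.Im z)).

Lemma expC0 : expC 0 = 1.
Proof. by rewrite /expC /= expR0 cos0 sin0 mulr1 mulr0. Qed.

Lemma expCD z w : expC (z + w) = expC z * expC w.
Proof.
case: z w => [a b] [c d]; rewrite /expC /=; simpc.
by rewrite expRD cosD sinD; congr (_ +i* _); ring.
Qed.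

Lemma real_taylor1 (f : R -> R) (f' : R) e :
  is_derive (0 : R) (1 : R) f f' -> 0 < e ->
  exists2 d : R, 0 < d &
    forall x, `|x| < d -> `|f x - f 0 - x * f'| <= e * `|x|.
Proof.
move=> df e0; have [/derivable_nbhsP/eqaddoP H <-] := df.
have := H e e0; rewrite near_simpl => /nbhs_ballP[d /= d0 Hd].
exists d => // x xd; have := Hd x.
rewrite -ball_normE /= sub0r normrN => /(_ xd).
rewrite !fctE /= addr0 [_%:A]mulr1 /cst /=.
by rewrite opprD addrA.
Qed.

(** Real and imaginary parts split into the first-order errors of exp, cos and sin at 0, plus
    products of small factors. *)
Lemma expC_taylor1 e : 0 < e ->
  exists2 d : R, 0 < d &
    forall w, `|w| < d%:C -> `|expC w - 1 - w| <= e%:C * `|w|.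
Proof.
move=> e0; pose E : R := expR 1.
have E1 : 0 < E by exact: expR_gt0.
(* The bounds [B1] to [B5] below add up to (2E + 3) f r; [f <= 1] keeps r below 1, so that e^x is at
   most E. *)
have [f [f0 f1 fe]] : exists f : R, [/\ 0 < f, f <= 1 & (2 * E + 3) * f <= e].
  have E3 : 0 < 2 * E + 3 by lra.
  exists (Num.min 1 (e / (2 * E + 3))).
  split; first by rewrite lt_min ltr01 divr_gt0.
    by rewrite ge_min lexx.
  by rewrite mulrC -ler_pdivlMr // ge_min lexx orbT.
have [d1 d10 H1] := real_taylor1 (is_derive_expR 0) f0.
have [d2 d20 H2] := real_taylor1 (is_derive_cos 0) f0.
have [d3 d30 H3] := real_taylor1 (is_derive_sin 0) f0.
exists (Num.min (Num.min d1 d2) (Num.min d3 f)).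
  by rewrite !lt_min d10 d20 d30 f0.
move=> w; have := Re_le_norm w; have := Im_le_norm w.
have [r ->] : exists r, `|w| = r%:C by rewrite normc_def; eexists.
case: w => x y /=; rewrite !lecR ltcR !lt_min => yr xr.
move=> /andP[/andP[r1 r2] /andP[r3 rf]].
have {H1} := H1 _ (le_lt_trans xr r1); have {H2} := H2 _ (le_lt_trans yr r2).
have {H3} := H3 _ (le_lt_trans yr r3).
rewrite sin0 cos0 expR0 oppr0 mulr0 !addr0 !subr0 !mulr1 => H3 H2 H1.
have r0 : 0 <= r by exact: le_trans xr.
have EE : `|expR x| <= E.
  rewrite ger0_norm ?expR_ge0 // ler_expR.
  by apply: le_trans (ler_norm _) _; lra.
apply: le_trans (norm_le_ReIm _) _; rewrite -rmorphM lecR /= subr0.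
have -> : expR x * cos y - 1 - x = (expR x - 1 - x) + expR x * (cos y - 1).
  by ring.
have -> : expR x * sin y - y =
    expR x * (sin y - y) + (x * y + (expR x - 1 - x) * y) by ring.
have B1 : `|expR x - 1 - x| <= f * r.
  by rewrite (le_trans H1) // ler_pM2l.
have B2 : `|expR x * (cos y - 1)| <= E * (f * r).
  by rewrite normrM ler_pM // (le_trans H2) // ler_pM2l.
have B3 : `|expR x * (sin y - y)| <= E * (f * r).
  by rewrite normrM ler_pM // (le_trans H3) // ler_pM2l.
have B4 : `|x * y| <= f * r.
  by rewrite normrM ler_pM // (le_trans xr) // ltW.
have B5 : `|(expR x - 1 - x) * y| <= f * r.
  rewrite normrM; apply: le_trans (ler_pM _ _ B1 yr) _ => //.
  by rewrite ler_piMr ?mulr_ge0 ?(ltW f0) //; lra.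
apply: le_trans (lerD (ler_normD _ _) (ler_normD _ _)) _.
apply: le_trans (lerD (lerD B1 B2) (lerD B3 (ler_normD _ _))) _.
apply: le_trans (_ : (2 * E + 3) * f * r <= _); last by rewrite ler_wpM2r.
have := lerD B4 B5; lra.
Qed.

(** By [expCD] the error of the difference quotient at [t] reduces to the first-order error of
    [expC] at 0. *)
Lemma is_derive_expC (z c t : R[i]) :
  is_derive (t : R[i]^o) (1 : R[i]^o)
    (fun s : R[i]^o => z * expC (s * c) : R[i]^o) (z * expC (t * c) * c).
Proof.
suff H : ((fun h : R[i]^o => h^-1 *:
      (((fun s : R[i]^o => z * expC (s * c) : R[i]^o) \o shift t) (h *: 1)
       - (z * expC (t * c) : R[i]^o)))
    @ (0 : R[i]^o)^' --> (z * expC (t * c) * c : R[i]^o))%classic.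
  by split; [apply: cvgP H | apply: cvg_lim H].
set A := z * expC (t * c).
have normE w : exists2 r : R, 0 <= r & `|w| = r%:C.
  by rewrite normc_def; eexists; last by []; exact: sqrtr_ge0.
have [M M0 AM] := normE (A * c); have [C C0 cC] := normE c.
apply/cvgrPdist_le => /= e e0.
have [r er r0] : exists2 r, e = r%:C & 0 < r.
  by case: e e0 => a b; rewrite ltcE /= => /andP[/eqP -> a0]; exists a.
have M1 : 0 < M + 1 by lra.
have C1 : 0 < C + 1 by lra.
(* The final error is at most r M / (M + 1); adding 1 to M and C avoids division by zero. *)
have [d d0 Hd] := expC_taylor1 (divr_gt0 r0 M1).
near=> h.
have h0 : h != 0 by near: h; exact: nbhs_dnbhs_neq.
have hd : `|h| < (d / (C + 1))%:C.
  near: h; apply: nbhs_dnbhs; apply/nbhs_ballP.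
  exists (d / (C + 1))%:C; first by rewrite /= ltcR divr_gt0.
  by move=> h; rewrite -ball_normE /= sub0r normrN.
have hcd : `|h * c| < d%:C.
  rewrite normrM cC; apply: le_lt_trans (_ : `|h| * (C + 1)%:C < _).
    by rewrite ler_wpM2l // lecR; lra.
  by rewrite -[d](divfK (lt0r_neq0 C1)) rmorphM /= ltr_pM2r // ltcR.
have -> : A * c - h^-1 *: (z * expC ((h *: 1 + t) * c) - A) =
    - (A * h^-1 * (expC (h * c) - 1 - h * c)).
  rewrite [h *: 1]mulr1 mulrDl expCD [expC (h * c) * _]mulrC mulrA -/A.
  rewrite /GRing.scale /=.
  by field.
clearbody A; rewrite normrN !normrM normfV.
apply: (@le_trans _ _ (`|A| * `|h|^-1 * ((r / (M + 1))%:C * `|h * c|))).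
  by rewrite ler_wpM2l ?mulr_ge0 ?invr_ge0 // Hd.
have -> : `|A| * `|h|^-1 * ((r / (M + 1))%:C * `|h * c|) =
    (r / (M + 1))%:C * `|A * c|.
  by rewrite mulrCA; congr (_ * _); rewrite !normrM mulrA divfK ?normr_eq0.
rewrite AM er -rmorphM lecR /= -mulrA ler_piMr ?(ltW r0) //.
by rewrite mulrC ler_pdivrMr //; lra.
Unshelve. all: by end_near.
Qed.

End ComplexExponential.

(** * Polynomial integral curves of triangular fields *)

Section PolynomialFlow.
Variable K : numFieldType.
Implicit Types p : {poly K}.

Lemma is_derive_horner p (t : K^o) :
  is_derive t (1 : K^o) (fun s : K^o => p.[s] : K^o) p^`().[t].
Proof.
elim/poly_ind: p => [|p c IHp].
  rewrite (_ : (fun s => _) = cst 0); last first.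
    by apply/funext => s; rewrite horner0.
  by rewrite deriv0 horner0; exact: is_derive_cst.
have -> : (fun s : K^o => (p * 'X + c%:P).[s] : K^o) =
    ((fun s : K^o => p.[s] : K^o) * id + cst (c : K^o)).
  by apply/funext => s; rewrite !hornerE.
apply: is_derive_eq.
rewrite derivD derivC derivM derivX !hornerE /=.
by rewrite /GRing.scale /= mulr1 addrC mulrC.
Qed.

(** The primitive vanishing at 0: its constant coefficient is a quotient by zero, hence 0. *)
Definition integ p : {poly K} := \poly_(i < (size p).+1) (p`_i.-1 / i%:R).

Lemma deriv_integ p : (integ p)^`() = p.
Proof.
apply/polyP => i; rewrite coef_deriv coef_poly ltnS.
case: ltnP => [_|pi]; last by rewrite mul0rn nth_default.
by rewrite -[_ *+ _]mulr_natr divfK // pnatr_eq0.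
Qed.

Lemma integ0 p : (integ p).[0] = 0.
Proof. by rewrite horner_coef0 coef_poly /= invr0 mulr0. Qed.

Variable n : nat.
Implicit Types (q : mpoly.mpoly n K) (v w : 'I_n -> {poly K}) (i j : 'I_n).

Local Notation peval := (mpoly.mmap (@polyC K)).

Lemma horner_peval v q (t : K) :
  (peval v q).[t] = mpoly.meval (fun i => (v i).[t]) q.
Proof.
rewrite mpoly.mevalE /mpoly.mmap horner_sum; apply: eq_bigr => m _.
rewrite hornerM hornerC horner_prod; congr (_ * _); apply: eq_bigr => i _.
by rewrite horner_exp.
Qed.

(** Phrased by substituting curves, which is the form that the Picard iteration uses. *)
Definition triangular (X : vfield K n) : Prop :=
  forall i v w, (forall j, (i < j)%N -> v j = w j) ->
    peval v (X 0 i) = peval w (X 0 i).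

Fixpoint picard (X : vfield K n) (z : 'rV[K]_n) d i : {poly K} :=
  (z 0 i)%:P + if d is d'.+1 then integ (peval (picard X z d') (X 0 i)) else 0.

(** Component [i] of an iterate depends only on later components of the previous one, which are
    stable one step earlier. For d = 0 no index qualifies. *)
Lemma picard_stable X z d i : triangular X -> (n <= i + d)%N ->
  picard X z d i = picard X z d.+1 i.
Proof.
move=> triX; elim: d i => [|d IHd] i.
  by rewrite addn0 leqNgt ltn_ord.
move=> nid; rewrite [LHS]/= [RHS]/=; congr (_ + integ _).
apply: triX => j ij; apply: IHd; rewrite (leq_trans nid) // addnS -addSn.
by rewrite leq_add2r.
Qed.

(** The n-th iterate is a fixed point of the Picard operator. *)
Lemma triangular_flow (X : vfield K n) (z : 'rV[K]_n) : triangular X ->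
  exists v : 'I_n -> {poly K},
    forall i, (v i).[0] = z 0 i /\ (v i)^`() = peval v (X 0 i).
Proof.
move=> triX; exists (picard X z n) => i.
have -> : picard X z n i = (z 0 i)%:P + integ (peval (picard X z n) (X 0 i)).
  by rewrite picard_stable // leq_addl.
by rewrite hornerD hornerC integ0 addr0 derivD derivC add0r deriv_integ.
Qed.

End PolynomialFlow.

(** * Completeness of U, V and W *)

Section Completeness.
Variables (R : realType) (n : nat).
Local Notation K := R[i].

Lemma complete_triangular (X : vfield K n) : triangular X -> complete_vfield X.
Proof.
move=> triX; have /choice[v Hv] := fun z : 'rV[K]_n => triangular_flow z triX.
exists (fun t z => \row_i (v z i).[t]); split=> [z|z t i].
  by apply/rowP => i; rewrite mxE; case: (Hv z i).
rewrite (_ : (fun s => _) = (fun s : K^o => (v z i).[s] : K^o)); last first.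
  by apply/funext => s; rewrite mxE.
apply: is_derive_eq (is_derive_horner _ _) _.
have [_ ->] := Hv z i; rewrite horner_peval; apply: mpoly.meval_eq => j.
by rewrite mxE.
Qed.

Lemma triangularV : triangular (fieldV K n).
Proof.
move=> i v w vw; rewrite !mxE !rmorphD !rmorph_nat; congr (_ + _).
rewrite !summxE !rmorph_sum; apply: eq_big_nat => k /andP[k2 _].
rewrite !mxE [LHS]rmorphM [RHS]rmorphM [X in X * _ = _]rmorphM.
rewrite [X in _ = X * _]rmorphM !rmorph_nat /=.
(* The k-th summand points along z_(k-1), so k = i + 2 in component [i], and its coefficient
   involves only z_j with j >= k. *)
have [/eqP ik|_] := eqVneq i.+1 k.-1; last by rewrite !mulr0.
have vwk j : (k <= j)%N -> mpoly.mmap (@polyC K) v (Defs.coord K n j) =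
    mpoly.mmap (@polyC K) w (Defs.coord K n j).
  move=> kj; rewrite !rmorph_sum; apply: eq_bigr => l /eqP lj /=.
  rewrite !mpoly.mmapX !mpoly.mmap1U; apply: vw.
  by move: kj; rewrite -lj -(prednK (ltnW k2)) -(eqP ik) ltnS.
congr (_ * _ * _); last by rewrite !rmorphXn /= vwk.
by rewrite !rmorph_prod; apply: eq_big_nat => j /andP[/ltnW kj _]; exact: vwk.
Qed.

Lemma complete_fieldU : complete_vfield (fieldU K n).
Proof.
by apply: complete_triangular => i v w _; rewrite !mxE !rmorph_nat.
Qed.

Lemma complete_fieldW : complete_vfield (fieldW K n).
Proof.
pose c (z : 'rV[K]_n) := \prod_(1 <= j < n)
  mpoly.meval (z 0) (Defs.coord K n j) ^+ 2.
pose phi (t : K) (z : 'rV[K]_n) : 'rV[K]_n :=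
  \row_i if i.+1 == n then z 0 i * expC (t * c z) else z 0 i.
exists phi; split=> [z|z t i].
  by apply/rowP => i; rewrite mxE mul0r expC0 mulr1 if_same.
rewrite !mxE.
have [/eqP i_n|i_n] := eqVneq i.+1 n; last first.
  rewrite mulr0 rmorph0 (_ : (fun s => _) = cst (z 0 i : K^o)).
    exact: is_derive_cst.
  by apply/funext => s; rewrite mxE (negPf i_n).
rewrite (_ : (fun s => _) =
    (fun s : K^o => z 0 i * expC (s * c z) : K^o)); last first.
  by apply/funext => s; rewrite mxE i_n.
apply: is_derive_eq (is_derive_expC _ _ _) _.
(* Only z_n moves, so [c z] is constant along the flow and the equation for z_n is linear. *)
have coord_lt j : (j < n)%N -> mpoly.meval (phi t z 0) (Defs.coord K n j) =
    mpoly.meval (z 0) (Defs.coord K n j).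
  move=> jn; rewrite !rmorph_sum; apply: eq_bigr => l /eqP lj /=.
  by rewrite !mpoly.mevalXU mxE lj ltn_eqF.
rewrite mulr1 rmorphM rmorph_prod mulrC; congr (_ * _).
  by apply: eq_big_nat => j /andP[_ jn]; rewrite rmorphXn /= coord_lt.
have -> : Defs.coord K n n = mpoly.mpolyX K (mpoly.mnm1 i).
  by rewrite -(coordE K i) (eqP i_n).
by rewrite /= mpoly.mevalXU mxE i_n.
Qed.

End Completeness.

Theorem theorem7 (R : realType) (n : nat) (hn : (2 <= n)%N) :
  [/\ complete_vfield (fieldU R[i] n),
      complete_vfield (fieldV R[i] n),
      complete_vfield (fieldW R[i] n)
    & forall X : vfield R[i] n,
        lie_generated
          (fun Y => [\/ Y = fieldU R[i] n, Y = fieldV R[i] n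
                      | Y = fieldW R[i] n]) X].
Proof.
split; [exact: complete_fieldU| |exact: complete_fieldW|].
  exact/complete_triangular/triangularV.
case: n hn => // n n_gt0 X S lieS genS.
apply: lie_generators_full => //; apply: genS.
- exact: Or31.
- exact: Or32.
- exact: Or33.
Qed.
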